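(* If a snark $G$ contains a heavy pentagon, then $G$ has a cycle cover of length at most $\frac{4}{3}|E(G)|+1$, i.e. $\mathrm{scc}(G)\le \frac{4}{3}|E(G)|+1$.
   Context: Graphs are finite; loops and multiple edges are allowed. A snark is a $2$-connected cubic graph with no proper $3$-edge-colouring. A pentagon (circuit of length $5$) $D$ in $G$ is heavy if $D$ contains an edge $uv$ such that the graph $G-\{u,v\}$ admits a proper $3$-edge-colouring. A cycle is a subgraph in which every vertex has even degree; a cycle cover is a collection of cycles covering every edge; its length is the sum of the numbers of edges of its cycles; $\mathrm{scc}(G)$ is the minimum length of a cycle cover of $G$. *)

(* Defs.v *)
From HB Require Import structures.
From mathcomp Require Import all_boot all_order all_algebra.
Set Implicit Arguments. Unset Strict Implicit. Unset Printing Implicit Defensive.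

Record graph := Graph {
  gV : finType;
  gE : finType;
  src : gE -> gV;
  tgt : gE -> gV }.

Section Graphs.
Variable G : graph.
Local Notation V := (gV G).
Local Notation E := (gE G).

Definition incident (e : E) (v : V) : bool := (src e == v) || (tgt e == v).

(* degree of v in the spanning subgraph with edge set C; loops count twice *)
Definition deg_in (C : {set E}) (v : V) : nat :=
  #|[set e in C | src e == v]| + #|[set e in C | tgt e == v]|.

Definition cubic : Prop := forall v : V, deg_in setT v = 3.

Definition adj_in (S : {set V}) : rel V := fun x y =>
  [exists e : E, [&& src e \in S, tgt e \in S &
     ((src e == x) && (tgt e == y)) || ((src e == y) && (tgt e == x))]].

Definition connected_on (S : {set V}) : Prop :=
  forall x y, x \in S -> y \in S -> connect (adj_in S) x y.

Definition two_connected : Prop :=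
  2 < #|V| /\ connected_on setT /\ forall v : V, connected_on (~: [set v]).

Definition colourable3_on (S : {set E}) : Prop :=
  exists c : E -> 'I_3, forall e f, e \in S -> f \in S -> e != f ->
    (exists v, incident e v && incident f v) -> c e != c f.

Definition snark : Prop :=
  two_connected /\ cubic /\ ~ colourable3_on setT.

Definition edges_avoiding (u v : V) : {set E} :=
  [set e | ~~ incident e u & ~~ incident e v].

Definition pentagon (D : {set E}) : Prop :=
  exists (p : 'I_5 -> V) (q : 'I_5 -> E),
    injective p /\ injective q /\ D = [set q i | i in 'I_5] /\
    forall i : 'I_5,
      ((src (q i) == p i) && (tgt (q i) == p (ordS i))) ||
      ((src (q i) == p (ordS i)) && (tgt (q i) == p i)).

Definition heavy_pentagon (D : {set E}) : Prop :=
  pentagon D /\ exists e, e \in D /\ colourable3_on (edges_avoiding (src e) (tgt e)).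

Definition is_cycle (C : {set E}) : Prop := forall v : V, ~~ odd (deg_in C v).

Definition cycle_cover (s : seq {set E}) : Prop :=
  (forall C, C \in s -> is_cycle C) /\ (forall e : E, exists2 C, C \in s & e \in C).

Definition cover_length (s : seq {set E}) : nat := \sum_(C <- s) #|C|.

End Graphs.

(* Main.v *)
Require Import Defs.
From mathcomp Require Import all_boot all_order all_algebra zify lra.
Import GRing.Theory Num.Theory.
Set Implicit Arguments. Unset Strict Implicit. Unset Printing Implicit Defensive.

(* Deleting the edges of the pentagon p0 p1 p2 p3 p4 from G leaves a graph that can
   be 3-edge-coloured at every vertex off the pentagon; the colouring is a pair
   (s, t) of edge sets that are even off the pentagon, with colours 1 = (1, 0),
   2 = (0, 1), 3 = (1, 1). If the colours of the five edges leaving the pentagon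
   do not extend over the pentagon, they are 1, 1, 2, 1, 3 up to rotation and
   renaming of colours. Since no Kempe switch may produce an extendable pattern,
   the (1, 3)-chain A leaving at p4 returns at p0, and, after switching along A, the
   (1, 2)-chain P leaving at p2 returns at p3. So A, B = s + A + P and C = t + P
   become cycles of G on adding the edge p4 p0, p1 p2, p3 p4 respectively; with
   the pentagon they cover G. Off the pentagon they cover the edges of original
   colour 3 twice and all others once, which gives length 4/3 |E| + 1. *)

(** * Degree parities of edge sets, joins and even covers *)

Section Parity.
Variable G : graph.
Local Notation V := (gV G).
Local Notation E := (gE G).
Implicit Types (f g s t : E -> bool) (e : E) (v : V).

Definition wt e v : nat := (src e == v) + (tgt e == v).

Definition deg f v : nat := \sum_e f e * wt e v.

Lemma deg_inE (C : {set E}) v : deg_in C v = deg (fun e => e \in C) v.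
Proof.
rewrite /deg_in /deg /wt -2!sum1_card ![\sum_(e in _) 1]big_mkcond -big_split /=.
by apply: eq_bigr => e _; rewrite !inE; case: (e \in C); case: (src e == v); case: (tgt e == v).
Qed.

(** Edge sets are Boolean functions, so that symmetric difference is pointwise [addb] and parity is
    additive over Z/2. *)
Definition par f v : bool := odd (deg f v).

Lemma eq_deg f g v : f =1 g -> deg f v = deg g v.
Proof. by move=> fg; apply: eq_bigr => e _; rewrite fg. Qed.

Lemma odd_sum (I : finType) (F : I -> nat) :
  odd (\sum_i F i) = \big[addb/false]_i odd (F i).
Proof. exact: (big_morph odd oddD (erefl _)). Qed.

Lemma par_xor f g v : par (fun e => f e (+) g e) v = par f v (+) par g v.
Proof.
rewrite /par /deg !odd_sum -big_split; apply: eq_bigr => e _ /=.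
by rewrite !oddM; case: (f e); case: (g e); case: (odd (wt e v)).
Qed.

Lemma deg0 v : deg xpred0 v = 0.
Proof. by rewrite /deg big1. Qed.

Lemma wt_sum e : \sum_v wt e v = 2.
Proof.
rewrite big_split /= -!(big_mkcond (fun v => _ == v) (fun=> 1)) /=.
by rewrite !(eq_bigl (fun v => v == _) _ (fun v => eq_sym _ v)) !big_pred1_eq.
Qed.

Lemma deg_sum f : \sum_v deg f v = (\sum_e f e).*2.
Proof.
rewrite exchange_big -muln2 big_distrl /=; apply: eq_bigr => e _.
by rewrite -big_distrr wt_sum.
Qed.

Lemma deg_union f g v :
  deg (fun e => f e || g e) v + deg (fun e => f e && g e) v = deg f v + deg g v.
Proof.
rewrite -!big_split; apply: eq_bigr => e _ /=.
by case: (f e); case: (g e); rewrite ?addn0.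
Qed.

Lemma deg_le f g v : (forall e, f e -> g e) -> deg f v <= deg g v.
Proof.
move=> fg; apply: leq_sum => e _; have := fg e.
by case: (f e) => // ->.
Qed.

Lemma par_edge e v : par (eq_op^~ e) v = (src e == v) (+) (tgt e == v).
Proof.
rewrite /par /deg (bigD1 e) //= eqxx mul1n big1 => [|f /negPf -> //].
by rewrite addn0 /wt; do 2!case: eqP.
Qed.

(** Loops at [v] and edges missing [v] contribute even amounts, so an odd degree needs an edge with
    exactly one end at [v]. *)
Lemma par_witness f v : par f v ->
  exists e, f e /\ (src e == v) (+) (tgt e == v).
Proof.
case: (pickP (fun e => f e && ((src e == v) (+) (tgt e == v)))).
  by move=> e /andP[? ?] _; exists e.
move=> none; rewrite /par /deg odd_sum big1 // => e _.
have := none e; rewrite oddM /wt.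
by case: (f e); case: (src e == v); case: (tgt e == v).
Qed.

(* A component of [f] meeting an odd vertex contains a second one: follow a path. *)
Lemma join_exists f v : par f v ->
  exists g w, [/\ forall e, g e -> f e, w != v, par f w &
    forall x, par g x = (x == v) (+) (x == w)].
Proof.
move: {2}(\sum_e f e) (leqnn (\sum_e f e)) => n.
elim: n => [|n IHn] in f v *.
  move=> f0 /par_witness[e [fe _]]; move: f0.
  by rewrite (bigD1 e) //= fe.
move=> fn fv; have [e [fe ev]] := par_witness fv.
have [w [wv parE]] : exists w, w != v /\ forall x, par (eq_op^~ e) x = (x == v) (+) (x == w).
  case: (eqVneq (src e) v) ev => [sv|sv] /= ev.
    exists (tgt e); split; first by [].
    by move=> x; rewrite par_edge sv ![_ == x]eq_sym.
  exists (src e); split => // x.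
  by rewrite par_edge (eqP ev) ![_ == x]eq_sym addbC.
have [fw|fw] := boolP (par f w).
  by exists (eq_op^~ e), w; split=> // x /eqP->.
(* Deleting [e] moves the odd vertex from [v] to [w]; the path continues from [w] with fewer
   edges. *)
pose h x := f x (+) (x == e).
have hsub x : h x -> f x by rewrite /h; case: eqP => [->|]; rewrite ?fe ?addbF.
have hn : \sum_e h e <= n.
  rewrite (bigD1 e) //= fe add1n ltnS in fn.
  rewrite (bigD1 e) //= {1}/h fe eqxx /= add0n; apply: leq_trans fn.
  by rewrite /h; apply: leq_sum => x /negPf ->; rewrite addbF.
have hp x : par h x = par f x (+) ((x == v) (+) (x == w)).
  by rewrite /h par_xor parE.
have hw : par h w by rewrite hp (negPf fw) eqxx (negPf wv).
have [g [u [gh uw hu gp]]] := IHn h w hn hw.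
(* The path cannot return to [v], which is even in [h]. *)
have uv : u != v.
  by apply: contraTneq hu => ->; rewrite hp fv eqxx eq_sym (negPf wv).
exists (fun x => g x (+) (x == e)), u; split=> //.
- move=> x; case: (x =P e) => [-> //|_]; rewrite addbF => /gh; exact: hsub.
- by move: hu; rewrite hp (negPf uv) (negPf uw) !addbF.
- move=> x; rewrite par_xor gp parE.
  by case: (x == w); case: (x == v); case: (x == u).
Qed.

Lemma deg_ge2 f e1 e2 v : e1 != e2 -> f e1 -> f e2 ->
  incident e1 v -> incident e2 v -> 1 < deg f v.
Proof.
move=> ne f1 f2 i1 i2; rewrite /deg (bigD1 e1) //= (bigD1 e2) 1?eq_sym //= f1 f2 !mul1n.
have w1 e : incident e v -> 0 < wt e v by rewrite /incident /wt; do 2!case: eqP.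
by move: (w1 _ i1) (w1 _ i2); lia.
Qed.

Lemma deg_true v : deg xpredT v = deg_in [set: E] v.
Proof. by rewrite deg_inE; apply: eq_deg => e; rewrite inE. Qed.

(** At each vertex [s] and [t] have even degree at most 3 and together cover degree 3, so both have
    degree 2 and they share degree 1. Hence their intersection and their two differences are perfect
    matchings, which serve as colour classes. *)
Lemma even_cover_colourable s t : cubic G ->
  (forall v, ~~ par s v) -> (forall v, ~~ par t v) -> (forall e, s e || t e) ->
  colourable3_on [set: E].
Proof.
move=> cub ps pt st.
have D3 f v : deg f v <= 3.
  by rewrite -(cub v) -deg_true; apply: deg_le.
have stv v : deg s v = 2 /\ deg t v = 2.
  have := deg_union s t v; rewrite (eq_deg (g := xpredT)) // deg_true cub.
  have := D3 s v; have := D3 t v; have := ps v; have := pt v; rewrite /par.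
  by case: (deg s v) => [|[|[|[|]]]] //; case: (deg t v) => [|[|[|[|]]]] //.
have st1 v : deg (fun e => s e && t e) v = 1.
  have := deg_union s t v; rewrite (eq_deg (g := xpredT)) // deg_true cub.
  by have [-> ->] := stv v; case.
have diff f g v : deg f v = 2 -> deg (fun e => f e && g e) v = 1 ->
    deg (fun e => f e && ~~ g e) v = 1.
  move=> f2 fg; have := deg_union (fun e => f e && g e) (fun e => f e && ~~ g e) v.
  rewrite (eq_deg (g := f)) ?f2 ?fg => [|e]; last by case: (f e); case: (g e).
  rewrite [X in 2 + X](eq_deg (g := fun=> false)).
    by rewrite deg0 addn0 add1n => -[].
  by move=> e; case: (f e); case: (g e).
pose c e : 'I_3 := if s e && t e then inord 0 else if s e then inord 1 else inord 2.
exists c => e1 e2 _ _ ne [v /andP[i1 i2]]; apply/eqP => ec.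
have absurd f : f e1 -> f e2 -> deg f v = 1 -> False.
  by move=> f1 f2 f3; have := deg_ge2 ne f1 f2 i1 i2; rewrite f3.
have [sv tv] := stv v.
have ds := diff _ t _ sv (st1 v).
have dt := diff t s v tv; rewrite (eq_deg (g := fun e => s e && t e)) in dt; last first.
  by move=> e; rewrite andbC.
move/(_ (st1 v)) in dt.
move: ec; rewrite /c; have := st e1; have := st e2.
case s1: (s e1); case t1: (t e1); case s2: (s e2); case t2: (t e2) => //= _ _;
  try (by move/(congr1 (@nat_of_ord 3)); rewrite !inordK); move=> _.
- by apply: absurd (st1 v); rewrite ?s1 ?s2.
- by apply: absurd ds; rewrite ?s1 ?s2 ?t1 ?t2.
- by apply: absurd dt; rewrite ?s1 ?s2 ?t1 ?t2.
Qed.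

Lemma cubic_deg_le3 f v : cubic G -> deg f v <= 3.
Proof. by move=> cub; rewrite -(cub v) -deg_true; apply: deg_le. Qed.

(* A loop at [v] leaves [v] with one further neighbour, which is a cutvertex. *)
Lemma loopless e : two_connected G -> cubic G -> src e != tgt e.
Proof.
move=> [V2 [_ con]] cub; apply/negP => /eqP le; set v := src e in le.
have := cub v; rewrite -deg_true /deg (bigD1 e) //= mul1n {1}/wt -le eqxx addn1 => -[E1].
have [f fe fv] : exists2 f, f != e & 0 < wt f v.
  apply/exists_inP; apply: contraT; rewrite negb_exists => /forallP none.
  move: E1; rewrite big1 // => f fe; have := none f; rewrite fe /= mul1n.
  by case: (wt f v).
move: E1; rewrite (bigD1 f) //= mul1n => E1.
have f1 : wt f v = 1 by move: fv E1; case: (wt f v) => [|[|n]] //; lia.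
have only (g : E) : incident g v -> g = e \/ g = f.
  move=> gv; case: (g =P e) => [|/eqP ge]; first by left.
  case: (g =P f) => [|/eqP gf]; first by right.
  move: E1; rewrite (bigD1 g) ?ge //= f1.
  have : 0 < wt g v by move: gv; rewrite /incident /wt; do 2!case: eqP.
  lia.
have [z zv fz] : exists2 z, z != v & incident f z.
  move: f1; rewrite /wt; case: (src f =P v) => [|/eqP] sf; case: (tgt f =P v) => [|/eqP] tf // _.
    by exists (tgt f); rewrite // /incident eqxx orbT.
  by exists (src f); rewrite // /incident eqxx.
have [y yv yz] : exists2 y, y != v & y != z.
  apply/exists_inP; apply: contraLR V2; rewrite negb_exists -leqNgt => /forallP none.
  have <- : #|[set v; z]| = 2 by rewrite cards2 [v == z]eq_sym zv.
  apply/subset_leq_card/subsetP => x _; have := none x.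
  by rewrite negb_and !negbK !inE.
have vin : v \in ~: [set z] by rewrite !inE eq_sym.
have yin : y \in ~: [set z] by rewrite !inE.
have /connectP[pth] := con z v y vin yin.
(* A walk avoiding [z] cannot leave [v]: [e] is a loop, and [f], the only other edge at [v], ends at
   [z]. *)
have stay (l : seq V) x : path (adj_in (~: [set z])) v l -> x = last v l -> x = v.
  elim: l => [|w l IHl] //= /andP[vw pl] xl.
  suff wv : w = v by apply: IHl; rewrite wv in pl xl.
  move: vw => /existsP[g /and3P[]]; rewrite !inE => gs gt gvw.
  have /only[|] : incident g v.
    by rewrite /incident; case/orP: gvw => /andP[a b]; rewrite ?a ?b ?orbT.
  - move=> ge; move: gvw; rewrite ge -le -/v.
    by case/orP => /andP[/eqP ? /eqP ?].
  - by move=> gf; move: fz; rewrite -gf /incident (negPf gs) (negPf gt).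
by move=> /stay h /h yv'; rewrite yv' eqxx in yv.
Qed.

End Parity.

(** * Adding pentagon edges to an edge set *)

Section Pentagon.
Variable G : graph.
Local Notation V := (gV G).
Local Notation E := (gE G).
Implicit Types (s t : E -> bool) (e : E) (v : V) (p : 'I_5 -> V) (q : 'I_5 -> E).

Definition pentagon_at p q : Prop := [/\ injective p, injective q &
  forall i, ((src (q i) == p i) && (tgt (q i) == p (ordS i))) ||
            ((src (q i) == p (ordS i)) && (tgt (q i) == p i))].

Definition o0 : 'I_5 := @Ordinal 5 0 isT.
Definition o1 : 'I_5 := @Ordinal 5 1 isT.
Definition o2 : 'I_5 := @Ordinal 5 2 isT.
Definition o3 : 'I_5 := @Ordinal 5 3 isT.
Definition o4 : 'I_5 := @Ordinal 5 4 isT.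

Lemma ordS_o : (ordS o0 = o1) * (ordS o1 = o2) * (ordS o2 = o3) * (ordS o3 = o4) * (ordS o4 = o0).
Proof. by do !split; apply: val_inj. Qed.

Lemma ord5P (P : 'I_5 -> Prop) : P o0 -> P o1 -> P o2 -> P o3 -> P o4 -> forall i, P i.
Proof.
move=> P0 P1 P2 P3 P4 [[|[|[|[|[|//]]]]] lti].
- by rewrite (_ : Ordinal _ = o0) //; apply: val_inj.
- by rewrite (_ : Ordinal _ = o1) //; apply: val_inj.
- by rewrite (_ : Ordinal _ = o2) //; apply: val_inj.
- by rewrite (_ : Ordinal _ = o3) //; apply: val_inj.
- by rewrite (_ : Ordinal _ = o4) //; apply: val_inj.
Qed.

Lemma big_ord5 (T : Type) (idx : T) (op : Monoid.law idx) (F : 'I_5 -> T) :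
  \big[op/idx]_i F i = op (F o0) (op (F o1) (op (F o2) (op (F o3) (F o4)))).
Proof.
rewrite !big_ord_recl big_ord0 Monoid.mulm1.
by do 4!(congr (op _ _); first by congr F; apply: val_inj); congr F; apply: val_inj.
Qed.

Lemma sum_codom (T : finType) (r : 'I_5 -> T) (F : T -> nat) : injective r ->
  \sum_x F x = \sum_(x | x \notin codom r) F x + \sum_i F (r i).
Proof.
move=> ir; rewrite (bigID (fun x => x \in codom r)) /= addnC; congr addn.
rewrite -(big_uniq _ (_ : uniq (codom r))) /=; last by rewrite map_inj_uniq ?enum_uniq.
by rewrite /codom /image_mem big_map big_enum.
Qed.

Lemma pentagon_rot p q : pentagon_at p q -> pentagon_at (p \o @ordS 5) (q \o @ordS 5).
Proof.
move=> [ip iq pq]; split=> [||i]; [| |exact: pq].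
- by apply: inj_comp => //; exact: ordS_inj.
- by apply: inj_comp => //; exact: ordS_inj.
Qed.

Variables (p : 'I_5 -> V) (q : 'I_5 -> E).
Hypothesis pq : pentagon_at p q.

Lemma wt_pentagon i v : wt (q i) v = (p i == v) + (p (ordS i) == v).
Proof.
case: pq => _ _ /(_ i); rewrite /wt.
by case/orP => /andP[/eqP-> /eqP->]; rewrite // addnC.
Qed.

Definition ext s (ys : seq bool) e : bool :=
  s e || [exists i : 'I_5, (q i == e) && nth false ys i].

Lemma ext_off s ys e : e \notin codom q -> ext s ys e = s e.
Proof.
move=> eq; rewrite /ext; case: existsP => [[i /andP[/eqP qi _]]|]; last by rewrite orbF.
by rewrite -qi codom_f in eq.
Qed.

Lemma ext_on s ys i : ~~ s (q i) -> ext s ys (q i) = nth false ys i.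
Proof.
have [_ iq _] := pq; rewrite /ext => /negPf-> /=.
apply/existsP/idP => [[j /andP[/eqP/iq <-]]|yi] //.
by exists i; rewrite eqxx.
Qed.

Lemma par_ext s ys v : (forall i, ~~ s (q i)) ->
  par (ext s ys) v = par s v (+) odd (\sum_(i < 5) nth false ys i * wt (q i) v).
Proof.
move=> sq; have [_ iq _] := pq; rewrite /par /deg (sum_codom _ iq) [in RHS](sum_codom _ iq).
rewrite [X in _ + X](eq_bigr _ (fun i _ => congr1 (fun b : bool => b * _) (ext_on ys (sq i)))).
rewrite (eq_bigr (fun e => s e * wt e v)) => [|e /ext_off -> //].
rewrite oddD; congr addb.
by rewrite [X in _ + X]big1 ?addn0 // => i _; rewrite (negPf (sq i)).
Qed.

Lemma par_ext_pentagon s ys i : (forall i, ~~ s (q i)) ->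
  par (ext s ys) (p (ordS i)) =
    par s (p (ordS i)) (+) (nth false ys i (+) nth false ys (ordS i)).
Proof.
have [ip _ _] := pq => sq; rewrite par_ext //; congr addb.
under eq_bigr => j _ do rewrite wt_pentagon !(inj_eq ip).
rewrite big_ord5.
by elim/ord5P: i; rewrite !ordS_o /= ?muln0 ?muln1 ?addn0 ?add0n ?oddD ?oddb //= addbC.
Qed.

Lemma par_ext_off s ys v : (forall i, ~~ s (q i)) -> v \notin codom p ->
  par (ext s ys) v = par s v.
Proof.
move=> sq vp; rewrite par_ext // big1 ?addbF // => i _.
rewrite wt_pentagon; have np j : (p j == v) = false.
  by apply: contraNF vp => /eqP<-; exact: codom_f.
by rewrite !np muln0.
Qed.

Lemma deg_off (f : E -> bool) v : v \notin codom p ->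
  deg (fun e => (e \notin codom q) && f e) v = deg f v.
Proof.
move=> vp; apply: eq_bigr => e _; case: (boolP (e \in _)) => //= /codomP[i ->].
have np j : (p j == v) = false by apply: contraNF vp => /eqP<-; exact: codom_f.
by rewrite wt_pentagon !np !muln0.
Qed.

(* A nowhere-zero (Z/2)^2-flow on the complement of the pentagon. The five edges
   leaving the pentagon carry the values [(par s (p i), par t (p i))]. *)
Definition outer_flow s t : Prop :=
  (forall v, v \notin codom p -> ~~ par s v && ~~ par t v) /\
  (forall e, s e || t e = (e \notin codom q)).

Lemma outer_off s t i : outer_flow s t -> ~~ s (q i) /\ ~~ t (q i).
Proof. by move=> [_ /(_ (q i))]; rewrite codom_f /=; case: (s _) (t _) => [] []. Qed.

Definition trace s : seq bool := [seq par s (p i) | i <- [:: o0; o1; o2; o3; o4]].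

(** * Extending an outer flow over the pentagon *)

Hypothesis cub : cubic G.
Hypothesis uncol : ~ colourable3_on [set: E].

(** One coordinate of the flow along the pentagon: once [b] is chosen on [q o0], evenness at [p o1]
    to [p o4] forces the other values. The head of [z] is dropped because evenness at [p o0] follows
    from the zero sum in [trace_sum]. *)
Definition pentagon_flow (b : bool) (z : seq bool) : seq bool :=
  b :: scanl addb b (behead z).

(** The pairs are the possible values on [q o0]; [orb] demands a nonzero value on every pentagon
    edge. *)
Definition extendable (zs zt : seq bool) : bool :=
  has (fun ab => all2 orb (pentagon_flow ab.1 zs) (pentagon_flow ab.2 zt))
    [:: (false, false); (false, true); (true, false); (true, true)].

(** Handshaking: the number of odd vertices is even, and all of them lie on the pentagon. *)
Lemma trace_sum s : (forall v, v \notin codom p -> ~~ par s v) ->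
  foldr addb false (trace s) = false.
Proof.
have [ip _ _] := pq => off; have : odd (\sum_v par s v) = false.
  rewrite odd_sum; under eq_bigr => v _ do rewrite oddb.
  by rewrite -odd_sum deg_sum odd_double.
rewrite (sum_codom _ ip) big1 => [|v /off /negPf -> //].
by rewrite odd_sum big_ord5 /trace /= !oddb addbF.
Qed.

Lemma ext_even s ys v : (forall i, ~~ s (q i)) ->
  (forall v, v \notin codom p -> ~~ par s v) ->
  (forall i : 'I_5, par s (p (ordS i)) = nth false ys i (+) nth false ys (ordS i)) ->
  ~~ par (ext s ys) v.
Proof.
move=> sq off sp; have [/codomP[i ->{v}]|vp] := boolP (v \in codom p); last first.
  by rewrite par_ext_off // off.
by rewrite -[i]ord_predK par_ext_pentagon // sp addbb.
Qed.

Lemma pentagon_flow_even s b v : (forall i, ~~ s (q i)) ->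
  (forall v, v \notin codom p -> ~~ par s v) ->
  ~~ par (ext s (pentagon_flow b (trace s))) v.
Proof.
move=> sq off; apply: ext_even => // i; have := trace_sum off; rewrite /trace /=.
by elim/ord5P: i; rewrite !ordS_o /=; do 5!case: par; case: b.
Qed.

(** An extension would consist of two everywhere even sets covering all edges, hence yield a
    3-edge-colouring. *)
Lemma outer_flow_not_extendable s t : outer_flow s t -> ~~ extendable (trace s) (trace t).
Proof.
move=> st; apply/negP => /hasP[[a b] _ /= /andP[]]; rewrite -/(all2 _ _ _) => ab0 ab1.
have [off cov] := st.
have sq i : ~~ s (q i) by have [] := outer_off i st.
have tq i : ~~ t (q i) by have [] := outer_off i st.
apply: uncol.
apply: (@even_cover_colourable _ (ext s (pentagon_flow a (trace s)))
  (ext t (pentagon_flow b (trace t)))) => // [v|v|e].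
- by apply: pentagon_flow_even => // w /off /andP[].
- by apply: pentagon_flow_even => // w /off /andP[].
have [/codomP[i ->]|eq] := boolP (e \in codom q); last by rewrite !ext_off // cov.
rewrite !ext_on //; move: ab0 ab1; rewrite /trace /=.
by case: a; case: b; elim/ord5P: i => /=; do 8!case: par.
Qed.


(** * From a colouring of the graph without two pentagon vertices to an outer flow *)

Hypothesis noloop : forall e : E, src e != tgt e.

Lemma wt_le1 e v : wt e v <= 1.
Proof.
rewrite /wt; case: (src e =P v) => [<-|_]; last by case: eqP.
by rewrite eq_sym (negPf (noloop e)).
Qed.

Lemma deg_le1 (f : E -> bool) v :
  (forall e1 e2, f e1 -> f e2 -> e1 != e2 -> ~~ (incident e1 v && incident e2 v)) ->
  deg f v <= 1.
Proof.
have wt0 e : ~~ incident e v -> wt e v = 0.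
  by rewrite /incident /wt negb_or => /andP[/negPf-> /negPf->].
move=> ne; rewrite /deg; case: (pickP (fun e => f e && incident e v)) => [e /andP[fe ev]|none].
  rewrite (bigD1 e) //= fe mul1n big1 ?addn0 ?wt_le1 // => e2 ee.
  case fe2: (f e2); rewrite ?mul0n // wt0 ?muln0 //.
  by have := ne _ _ fe fe2; rewrite ev eq_sym ee; apply.
rewrite big1 // => e _; have := none e.
by case: (f e) => //= /negbT /wt0 ->.
Qed.

Definition proper_off (A : {set E}) (c : E -> 'I_3) : Prop :=
  forall v e1 e2, v \notin codom p -> e1 \in A -> e2 \in A -> e1 != e2 ->
    incident e1 v -> incident e2 v -> c e1 != c e2.

(* At its outer end a pendant edge meets only two others, so a colour is free. *)
Lemma proper_off_extend A c e :
  (src e \in codom p) || (tgt e \in codom p) -> proper_off A c ->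
  exists c', proper_off (e |: A) c'.
Proof.
(* [y] is the end of [e] off the pentagon; if there is none, any colour will do. *)
move=> ep Ac; pose y := if src e \in codom p then tgt e else src e.
have ye v : v \notin codom p -> incident e v -> v = y.
  move=> vp; rewrite /incident /y; move: ep.
  case: ifP => [sp _|sp /= tp] /orP[] /eqP ev //; first by rewrite -ev sp in vp.
  by rewrite -ev tp in vp.
pose others := [set f | incident f y & f != e].
have others2 : #|others| < 3.
  rewrite -(cub y) -deg_true /deg (bigD1 e) //= mul1n -add1n leq_add //.
    by rewrite /wt /y; case: ifP; rewrite eqxx ?addn1 ?add1n.
  rewrite -sum1_card big_mkcond [X in _ <= X]big_mkcond /=; apply: leq_sum => f _.
  rewrite !inE; case: (f != e); rewrite ?andbF ?andbT //= mul1n /incident /wt.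
  by do 2!case: eqP.
have [k kP] : exists k, k \notin [set c f | f in others].
  apply/existsP; rewrite -negb_forall; apply/negP => /forallP all.
  have : #|[set: 'I_3]| <= #|[set c f | f in others]|.
    by apply/subset_leq_card/subsetP => k _; exact: all.
  by rewrite cardsT card_ord => /leq_trans/(_ (leq_imset_card _ _)); rewrite leqNgt others2.
have kc f : f != e -> incident f y -> c f != k.
  by move=> fe fy; apply: contraNneq kP => <-; apply: imset_f; rewrite !inE fe fy.
exists (fun f => if f == e then k else c f) => v e1 e2 vp.
rewrite !inE; case: (e1 =P e) => [->|/eqP e1e]; case: (e2 =P e) => [->|/eqP e2e] //=.
- by rewrite eqxx.
- by move=> _ _ _ /(ye _ vp) -> i2; rewrite eq_sym kc.
- by move=> _ _ _ i1 /(ye _ vp) yv; rewrite kc // -yv.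
- exact: Ac.
Qed.

(** Every edge still uncoloured meets [u] or [w], hence the pentagon, so these edges can be coloured
    greedily. Conflicts at pentagon vertices are harmless: [outer_flow] demands evenness only off
    the pentagon. *)
Lemma outer_flow_exists u w : u \in codom p -> w \in codom p ->
  colourable3_on (edges_avoiding u w) -> exists s t, outer_flow s t.
Proof.
move=> up wp [c0 c0P].
have [c cP] : exists c, proper_off [set: E] c.
  have : forall l : seq E, {subset l <= [predC edges_avoiding u w]} ->
      exists c, proper_off (edges_avoiding u w :|: [set e in l]) c.
    elim=> [_|e l IHl sub].
      exists c0 => v e1 e2 _; rewrite set_nil setU0 => a1 a2 ne i1 i2.
      by apply: c0P => //; exists v; rewrite i1.
    have [|c cP] := IHl; first by move=> f fl; apply: sub; rewrite inE fl orbT.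
    have [|c' cP'] := @proper_off_extend _ c e _ cP.
      have := sub e; rewrite !inE eqxx negb_and !negbK /incident => /(_ isT).
      by case/orP => /orP[] /eqP->; rewrite ?up ?wp ?orbT.
    exists c'; rewrite (_ : _ :|: _ = e |: (edges_avoiding u w :|: [set e in l])) //.
    by rewrite set_cons setUCA.
  case/(_ (enum (~: edges_avoiding u w))) => [e|c cP].
    by rewrite mem_enum !inE.
  exists c; rewrite (_ : [set: E] =
    edges_avoiding u w :|: [set e in enum (~: edges_avoiding u w)]) //.
  by apply/setP => e; rewrite inE in_setU in_set mem_enum in_setC orbN.
(* Each of the three colours has degree at most 1 at [v], and the three degrees add up to 3. *)
have one k v : v \notin codom p -> deg (fun e => c e == k) v = 1.
  move=> vp.
  have le1 j : deg (fun e => c e == j) v <= 1.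
    apply: deg_le1 => e1 e2 /eqP c1 /eqP c2 ne; apply/negP => /andP[i1 i2].
    by have := cP v e1 e2 vp (in_setT _) (in_setT _) ne i1 i2; rewrite c1 c2 eqxx.
  have : \sum_(j < 3) deg (fun e => c e == j) v = 3.
    rewrite -[RHS](cub v) -deg_true exchange_big; apply: eq_bigr => e _ /=.
    by rewrite -big_distrl /= (bigD1 (c e)) //= eqxx big1 // => j /negPf; rewrite eq_sym => ->.
  rewrite (bigD1 k) //= => sum3; have := le1 k; rewrite leq_eqVlt => /orP[/eqP //|].
  rewrite ltnS leqn0 => /eqP k0; move: sum3; rewrite k0 add0n => sum3.
  have : \sum_(j < 3 | j != k) deg (fun e => c e == j) v <= \sum_(j < 3 | j != k) 1.
    by apply: leq_sum.
  by rewrite sum3 sum1_card cardC1 card_ord.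
(* Off the pentagon [r k] carries the two colours other than [k], so its degree is 2. No edge has
   both colours [ord0] and [ord_max], so the two sets used below cover all outer edges. *)
pose r k e := (e \notin codom q) && (c e != k).
have parr k v : v \notin codom p -> ~~ par (r k) v.
  move=> vp; rewrite /par (_ : deg _ v = 2) //.
  rewrite deg_off //.
  have := deg_union (fun e => c e == k) (fun e => c e != k) v.
  rewrite (eq_deg (g := xpredT)) => [|e]; last by case: eqP.
  rewrite [X in _ + X](eq_deg (g := xpred0)) => [|e]; last by case: eqP.
  by rewrite deg0 deg_true cub one // add1n => -[].
exists (r ord0), (r ord_max); split=> [v vp|e]; first by rewrite !parr.
rewrite /r -andb_orr; case: (e \in codom q) => //=.
by case: eqP => // ->.
Qed.

End Pentagon.

(* [functional 0], [functional 1], [functional 2] are the nonzero linear forms on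
   (Z/2)^2; two distinct ones give a renaming of the colours. *)
Definition functional (k : nat) (a b : bool) : bool :=
  if k is 0 then a else if k is 1 then b else a (+) b.

(* The pattern 1, 1, 2, 1, 3, with colours 1 = (1, 0), 2 = (0, 1), 3 = (1, 1). *)
Definition standard (zs zt : seq bool) : bool :=
  (zs == [:: true; true; false; true; true]) && (zt == [:: false; false; true; false; true]).

Definition trace_functional k (zs zt : seq bool) : seq bool :=
  [seq functional k z.1 z.2 | z <- zip zs zt].

(** Five nonzero values with sum zero contain each colour an odd number of times, so the
    multiplicities are 3, 1, 1. If the two single colours are neighbours the pattern extends;
    otherwise it is standard up to rotation and renaming. The proof checks all cases. *)
Lemma standardize (zs zt : seq bool) : size zs = 5 -> size zt = 5 ->
  foldr addb false zs = false -> foldr addb false zt = false ->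
  all2 orb zs zt -> ~~ extendable zs zt ->
  has (fun r => has (fun k => has (fun l => (k != l) &&
    standard (rot r (trace_functional k zs zt)) (rot r (trace_functional l zs zt)))
  (iota 0 3)) (iota 0 3)) (iota 0 5).
Proof.
case: zs => [|a0 [|a1 [|a2 [|a3 [|a4 [|]]]]]] // _.
case: zt => [|b0 [|b1 [|b2 [|b3 [|b4 [|]]]]]] // _.
by case: a0; case: b0; case: a1; case: b1; case: a2; case: b2;
   case: a3; case: b3; case: a4; case: b4.
Qed.

(** * Normalising the outer flow *)

Section Cover.
Variable G : graph.
Local Notation V := (gV G).
Local Notation E := (gE G).
Implicit Types (s t : E -> bool) (e : E) (v : V) (p : 'I_5 -> V) (q : 'I_5 -> E).
Hypothesis cub : cubic G.
Hypothesis uncol : ~ colourable3_on [set: E].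

Lemma pentagon_rotate r p q : r <= 5 -> pentagon_at p q ->
  exists p' q', [/\ pentagon_at p' q', codom p' =i codom p, codom q' =i codom q &
    forall s, trace p' s = rot r (trace p s)].
Proof.
elim: r => [|r IHr] r5 pq; first by exists p, q; split=> // s; rewrite rot0.
have [p' [q' [pq' pE qE tE]]] := IHr (ltnW r5) pq.
have codomS (T : finType) (f : 'I_5 -> T) : codom (f \o @ordS 5) =i codom f.
  move=> x; apply/codomP/codomP => -[i ->]; first by exists (ordS i).
  by exists (ord_pred i); rewrite /= ord_predK.
exists (p' \o @ordS 5), (q' \o @ordS 5); split.
- exact: pentagon_rot.
- by move=> x; rewrite codomS pE.
- by move=> x; rewrite codomS qE.
- by move=> s; rewrite rotS ?size_map // -tE /trace /= !ordS_o.
Qed.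

Lemma deg_outer p q i : pentagon_at p q -> deg (fun e => e \notin codom q) (p i) = 1.
Proof.
move=> pq; have [ip iq _] := pq; have := cub (p i); rewrite -deg_true /deg !(sum_codom _ iq).
rewrite [X in _ -> _ + X = _]big1 => [|j _]; last by rewrite codom_f.
under [X in _ + X = _ -> _]eq_bigr => j _ do rewrite mul1n (wt_pentagon pq) !(inj_eq ip).
rewrite big_ord5 [X in _ -> X + _ = _](eq_bigr (fun e => 1 * wt e (p i))) => [|e ->//].
by elim/ord5P: i; rewrite !ordS_o /=; lia.
Qed.

Lemma deg_outer_le p q s t (f : E -> bool) i : pentagon_at p q -> outer_flow p q s t ->
  (forall e, f e -> s e || t e) -> deg f (p i) <= 1.
Proof.
move=> pq [_ cov] fst; rewrite -(deg_outer i pq); apply: deg_le => e /fst.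
by rewrite cov.
Qed.

Lemma outer_flow_nonzero p q s t i : pentagon_at p q -> outer_flow p q s t ->
  par s (p i) || par t (p i).
Proof.
move=> pq st; have [_ cov] := st.
have := deg_union s t (p i); rewrite (eq_deg (g := fun e => e \notin codom q)) //.
rewrite (deg_outer i pq) /par.
have: deg s (p i) <= 1 by apply: (deg_outer_le i pq st) => e ->.
have: deg t (p i) <= 1 by apply: (deg_outer_le i pq st) => e ->; rewrite orbT.
by case: (deg s _) => [|[|]] //; case: (deg t _) => [|[|]].
Qed.

Lemma par_functional k s t v :
  par (fun e => functional k (s e) (t e)) v = functional k (par s v) (par t v).
Proof. by case: k => [|[|k]] //=; exact: par_xor. Qed.

Lemma outer_flow_standard p q s t : pentagon_at p q -> outer_flow p q s t ->
  exists p' q' s' t', [/\ pentagon_at p' q', outer_flow p' q' s' t' &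
    standard (trace p' s') (trace p' t')].
Proof.
move=> pq st; have [off cov] := st.
have offs v : v \notin codom p -> ~~ par s v by move=> /off /andP[].
have offt v : v \notin codom p -> ~~ par t v by move=> /off /andP[].
have nz : all2 orb (trace p s) (trace p t).
  by rewrite /trace /= !(outer_flow_nonzero _ pq st).
have next := outer_flow_not_extendable pq cub uncol st.
have /hasP[r rP /hasP[k kP /hasP[l lP /andP[kl std]]]] :=
  @standardize (trace p s) (trace p t) erefl erefl
    (trace_sum pq offs) (trace_sum pq offt) nz next.
have r5 : r <= 5 by move: rP; rewrite mem_iota => /andP[_ /ltnW].
have [p' [q' [pq' pE qE tE]]] := pentagon_rotate r5 pq.
exists p', q', (fun e => functional k (s e) (t e)), (fun e => functional l (s e) (t e)).
split=> //; last first.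
  by rewrite !tE /trace /= !par_functional.
split=> [v|e].
  rewrite pE !par_functional => /off /andP[/negPf-> /negPf->].
  by case: (k) => [|[|?]]; case: (l) => [|[|?]].
(* Distinct functionals are independent, so they never vanish together on a nonzero value. *)
rewrite qE -cov; move: kP lP kl; rewrite !mem_iota.
by case: (k) => [|[|[|?]]]; case: (l) => [|[|[|?]]] //=; case: (s e); case: (t e).
Qed.

(** * Building the cycle cover and bounding its length *)

Lemma cycle_ext p q s ys : pentagon_at p q -> (forall i, ~~ s (q i)) ->
  (forall v, v \notin codom p -> ~~ par s v) ->
  (forall i : 'I_5, par s (p (ordS i)) = nth false ys i (+) nth false ys (ordS i)) ->
  is_cycle [set e | ext q s ys e].
Proof.
move=> pq sq off sp v; rewrite deg_inE.
have := ext_even pq v sq off sp.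
rewrite /par (eq_deg (g := fun e => e \in [set e | ext q s ys e])) //.
by move=> e; rewrite inE.
Qed.

Lemma cards_sum (f : E -> bool) : #|[set e | f e]| = \sum_e f e.
Proof. by rewrite -sum1_card big_mkcond; apply: eq_bigr => e _; rewrite inE; case: (f e). Qed.

(** The edges of colour 3 have degree at most 1 at each vertex off the pentagon, and on the pentagon
    they meet only [p o4]. Their degree sum is thus at most [#|V|] - 5 + 1. *)
Lemma both_count p q s t : pentagon_at p q -> outer_flow p q s t ->
  standard (trace p s) (trace p t) ->
  2 * (\sum_e (s e && t e)) + 4 <= #|V|.
Proof.
move=> pq st std; have [off cov] := st; have [ip iq _] := pq.
have degQ v : deg (fun e => e \notin codom q) v + deg (fun e => s e && t e) v = deg s v + deg t v.
  by rewrite -(deg_union s t); congr addn; apply: eq_deg => e; rewrite cov.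
have off1 v : v \notin codom p -> deg (fun e => s e && t e) v <= 1.
  move=> vp; have /andP[] := off v vp; rewrite /par; have := degQ v.
  have := cubic_deg_le3 s v cub; have := cubic_deg_le3 t v cub.
  have : deg (fun e => e \notin codom q) v = 3.
    by rewrite -[RHS](cub v) -deg_true -(deg_off pq xpredT) //; apply: eq_deg => e; rewrite andbT.
  by case: (deg s v) => [|[|[|[|]]]] //; case: (deg t v) => [|[|[|[|]]]] //; lia.
have on i : deg (fun e => s e && t e) (p i) = (i == o4).
  have := degQ (p i); rewrite (deg_outer i pq).
  have : deg s (p i) = par s (p i).
    have: deg s (p i) <= 1 by apply: (deg_outer_le i pq st) => e ->.
    by rewrite /par; case: (deg s _) => [|[|]].
  have -> : deg t (p i) = par t (p i).
    have: deg t (p i) <= 1 by apply: (deg_outer_le i pq st) => e ->; rewrite orbT.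
    by rewrite /par; case: (deg t _) => [|[|]].
  move=> ->; case/andP: std => /eqP[s0 s1 s2 s3 s4] /eqP[t0 t1 t2 t3 t4].
  by elim/ord5P: i; rewrite ?(s0, s1, s2, s3, s4, t0, t1, t2, t3, t4) => -[].
rewrite -sum1_card mul2n -deg_sum !(sum_codom _ ip).
under [X in _ + X + _ <= _]eq_bigr => i _ do rewrite on.
by rewrite -addnA !big_ord5 /= leq_add //; apply: leq_sum.
Qed.

(** The second odd vertex given by [join_exists] must lie on the pentagon, since [s] is even
    elsewhere. *)
Lemma outer_join p s j : injective p -> (forall v, v \notin codom p -> ~~ par s v) ->
  par s (p j) -> exists (A : E -> bool) i, [/\ forall e, A e -> s e, i != j, par s (p i),
    forall k : 'I_5, par A (p k) = (k == j) (+) (k == i) &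
    forall v, v \notin codom p -> ~~ par A v].
Proof.
move=> ip off /join_exists[A [w [As wj sw parA]]].
have [/codomP[i wi]|/off] := boolP (w \in codom p); last by rewrite sw.
rewrite {w}wi in wj sw parA.
exists A, i; split=> // [|k|v vp]; first by rewrite -(inj_eq ip).
  by rewrite parA !(inj_eq ip).
by rewrite parA; apply/negP; do 2?case: eqP => [vE|_] //; rewrite vE codom_f in vp.
Qed.

Lemma standard_cover p q s t : pentagon_at p q -> outer_flow p q s t ->
  standard (trace p s) (trace p t) ->
  exists2 C : seq {set E}, cycle_cover C & 3 * cover_length C <= 4 * #|E| + 3.
Proof.
move=> pq st std; have [off cov] := st; have [ip iq _] := pq.
have offs v : v \notin codom p -> ~~ par s v by move=> /off /andP[].
have offt v : v \notin codom p -> ~~ par t v by move=> /off /andP[].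
have sq i : s (q i) = false by have [/negPf] := outer_off i st.
have tq i : t (q i) = false by have [_ /negPf] := outer_off i st.
case/andP: (std) => /eqP[s0 s1 s2 s3 s4] /eqP[t0 t1 t2 t3 t4].
have [A [i [As i4 si parA offA]]] := outer_join ip offs s4.
(* As [A] lies in [s], adding it to [t] swaps colours 1 and 3 along [A]. *)
have sA : outer_flow p q s (fun e => t e (+) A e).
  split=> [v vp|e]; first by rewrite offs // par_xor (negPf (offt v vp)) (negPf (offA v vp)).
  by rewrite -cov; have := As e; case: (A e); case: (s e); case: (t e) => // /(_ isT).
(* If [A] ended at [p o1] or [p o3], the single colour 3 would move next to the 2 at [p o2], and the
   pattern would extend. *)
have i0 : i = o0.
  have := outer_flow_not_extendable pq cub uncol sA.
  rewrite /trace /= !par_xor !parA s0 s1 s2 s3 s4 t0 t1 t2 t3 t4.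
  by elim/ord5P: i i4 si {parA}; rewrite ?s2.
rewrite {i i4 si}i0 in parA.
(* The edges of colour 1 or 2 after the switch along [A]. *)
pose f e := s e (+) (t e (+) A e).
have parf v : par f v = par s v (+) (par t v (+) par A v) by rewrite /f !par_xor.
have offf v : v \notin codom p -> ~~ par f v.
  by move=> vp; rewrite parf (negPf (offs v vp)) (negPf (offt v vp)) (negPf (offA v vp)).
have f2 : par f (p o2) by rewrite parf parA s2 t2.
have [P [i [Pf i2 fi parP offP]]] := outer_join ip offf f2.
have sAP : outer_flow p q (fun e => s e (+) P e) (fun e => t e (+) A e (+) P e).
  split=> [v vp|e].
    rewrite !par_xor (negPf (offs v vp)) (negPf (offt v vp)).
    by rewrite (negPf (offA v vp)) (negPf (offP v vp)).
  have [_ /(_ e) <-] := sA.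
  by have := Pf e; rewrite /f; case: (P e); case: (s e); case: (t e (+) A e) => // /(_ isT).
(* The pattern is now 3, 1, 2, 1, 1. If [P] ended at [p o1] or [p o4], colour 2 would move next to
   the 3 at [p o0], and the pattern would extend. *)
have i3 : i = o3.
  have := outer_flow_not_extendable pq cub uncol sAP.
  rewrite /trace /= !par_xor !parA !parP s0 s1 s2 s3 s4 t0 t1 t2 t3 t4.
  by elim/ord5P: i i2 fi {parP}; rewrite ?parf ?parA ?s0 ?t0.
rewrite {i i2 fi}i3 in parP.
have Aq i : A (q i) = false by apply/negP => /As; rewrite sq.
have Pq i : P (q i) = false by apply/negP => /Pf; rewrite /f sq tq Aq.
pose B e := s e (+) A e (+) P e; pose C e := t e (+) P e.
have Bq i : B (q i) = false by rewrite /B sq Aq Pq.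
have Cq i : C (q i) = false by rewrite /C tq Pq.
have offB v : v \notin codom p -> ~~ par B v.
  by move=> vp; rewrite /B !par_xor (negPf (offs v vp)) (negPf (offA v vp)) (negPf (offP v vp)).
have offC v : v \notin codom p -> ~~ par C v.
  by move=> vp; rewrite /C !par_xor (negPf (offt v vp)) (negPf (offP v vp)).
(* The odd vertices of [A] are [p o4] and [p o0], those of [B] are [p o1] and [p o2], those of [C]
   are [p o3] and [p o4]; the added edges [q o4], [q o1], [q o3] join these pairs. *)
pose A' := ext q A [:: false; false; false; false; true].
pose B' := ext q B [:: false; true; false; false; false].
pose C' := ext q C [:: false; false; false; true; false].
pose D' := ext q xpred0 [:: true; true; true; true; true].
exists [:: [set e | A' e]; [set e | B' e]; [set e | C' e]; [set e | D' e]].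
  split=> [X|e].
    rewrite !inE => /or4P[] /eqP->; apply: (cycle_ext pq) => //.
    - by move=> i; rewrite Aq.
    - by elim/ord5P; rewrite !ordS_o parA.
    - by move=> i; rewrite Bq.
    - by elim/ord5P; rewrite !ordS_o /B !par_xor parA parP ?s0 ?s1 ?s2 ?s3 ?s4.
    - by move=> i; rewrite Cq.
    - by elim/ord5P; rewrite !ordS_o /C !par_xor parP ?t0 ?t1 ?t2 ?t3 ?t4.
    - by move=> v _; rewrite /par deg0.
    - by elim/ord5P; rewrite /par deg0.
  have [/codomP[i ->]|eq] := boolP (e \in codom q).
    exists [set e | D' e]; first by rewrite !inE eqxx !orbT.
    by rewrite inE /D' (ext_on pq) //; elim/ord5P: i.
  have : [|| A e, B e | C e].
    have := cov e; rewrite eq; have := As e; have := Pf e; rewrite /f /B /C.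
    by case: (A e); case: (P e); case: (s e); case: (t e) => // a b;
      try (by have := a isT); have := b isT.
  case/or3P => h.
  - by exists [set e | A' e]; rewrite !inE ?eqxx // /A' ext_off.
  - by exists [set e | B' e]; rewrite !inE ?eqxx ?orbT // /B' ext_off.
  - by exists [set e | C' e]; rewrite !inE ?eqxx ?orbT // /C' ext_off.
(* The 3 counts the pentagon edges used in addition to [D']; outer edges are covered twice exactly
   when their original colour is 3. *)
have count : #|E| + 3 + \sum_e (s e && t e) =
    #|[set e | A' e]| + #|[set e | B' e]| + #|[set e | C' e]| + #|[set e | D' e]|.
  rewrite !cards_sum -!big_split /= -sum1_card !(sum_codom _ iq).
  rewrite [X in _ = _ + X](eq_bigr (fun i : 'I_5 => nth 0 [:: 1; 2; 1; 2; 2] i)); last first.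
    move=> i _; rewrite /A' /B' /C' /D' !(ext_on pq) ?Aq ?Bq ?Cq //.
    by elim/ord5P: i.
  rewrite [X in _ + (_ + X) = _]big1 => [|i _]; last by rewrite sq.
  rewrite [X in _ = X + _](eq_bigr (fun e => 1 + (s e && t e))); last first.
    move=> e eq; rewrite /A' /B' /C' /D' !ext_off // addn0 /B /C.
    have := cov e; rewrite eq; have := As e; have := Pf e; rewrite /f.
    by case: (A e); case: (P e); case: (s e); case: (t e) => // a b;
      try (by have := a isT); have := b isT.
  rewrite big_split /= !big_ord5 /=; lia.
have vertices : 3 * #|V| = 2 * #|E|.
  rewrite -!sum1_card mul2n -(deg_sum xpredT) big_distrr /=.
  by apply: eq_bigr => v _; rewrite deg_true cub.
(* At most [#|V|] / 2 - 2 = [#|E|] / 3 - 2 edges have colour 3, so the total is at most 4/3 [#|E|] +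
   1. *)
have := both_count pq st std.
rewrite /cover_length !big_cons big_nil; lia.
Qed.
End Cover.

(** * The bound for snarks with a heavy pentagon *)

Local Open Scope ring_scope.

(* scc(G) <= 4/3 |E(G)| + 1, i.e. some cycle cover has length at most that *)
Theorem theorem7p3 (G : graph) :
  snark G -> (exists D : {set gE G}, heavy_pentagon D) ->
  exists s : seq {set gE G}, cycle_cover s /\
    ((cover_length s)%:R <= (4%:R / 3%:R) * (#|gE G|)%:R + 1 :> rat).
Proof.
move=> [con [cub uncol]] [D [[p [q [ip [iq [DE pq]]]]] [e [eD col]]]].
have pq' : pentagon_at p q by split.
have [i eq] : exists i, e = q i.
  by move: eD; rewrite DE => /imsetP[i _ ->]; exists i.
have [sp tp] : (src e \in codom p) /\ (tgt e \in codom p).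
  by rewrite eq; have /orP[] := pq i => /andP[/eqP-> /eqP->]; rewrite !codom_f.
have [s [t st]] := outer_flow_exists pq' cub (fun f => loopless f con cub) sp tp col.
have [p' [q' [s' [t' [pq'' st' std]]]]] := outer_flow_standard cub uncol pq' st.
have [C cC len] := standard_cover cub uncol pq'' st' std.
exists C; split=> //.
rewrite -(ler_nat rat) natrD !natrM in len.
lra.
Qed.
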